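(* Consider the traffic network system described in the context, with state space $S=[0,a_1]\times\dots\times[0,a_n]$, and suppose that the equilibrium assumption stated in the context holds with $x^*=(x_1^*,\dots,x_n^* )'\in S$ and equilibrium flows $f_i^*$. Assume that there exist constants $0\le b_i<c_i\le a_i$ ($i=1,\dots,n$) such that the set $A=[b_1,c_1]\times\dots\times[b_n,c_n]$ is a trapping region for the system. Moreover, assume that there exists a constant $L\ge 0$ such that for all $i=1,\dots,n$: $$|f_i(d,x_i)-f_i^*|\le L|x_i-x_i^*|\quad\text{for all }(d,x_i)\in D\times[0,a_i].$$ Furthermore, assume that there exist constants $\lambda_i,\mu_i\ge 0$, $\omega_i\in[x_i^*,a_i)$ ($i=1,\dots,n$) such that $$\left|x_i-x_i^*-\left(Q_i+\sum_{j=1}^n\frac{\min\left(a_j-\theta_j\omega_j,\ v_j+p_{i,j}f_i(d,x_i)+\sum_{k\ne i}p_{k,j}f_k^*\right)}{v_j+p_{i,j}f_i(d,x_i)+\sum_{k\ne i}p_{k,j}f_k^*}\,p_{i,j}\right)f_i(d,x_i)+\min\left(a_i-x_i,\ v_i+\sum_{j=1}^n p_{j,i}f_j^*\right)\right|\le\lambda_i|x_i-x_i^*|$$ for all $(d,x_i)\in D\times[b_i,c_i]$, $\theta=(\theta_1,\dots,\theta_n)\in[0,1]^n$ and $i=1,\dots,n$, and $$|f_i^*-f_i(d,x_i)|\le\mu_i|x_i-x_i^*|\quad\text{for all }(d,x_i)\in D\times[b_i,c_i]\text{ and }i=1,\dots,n.$$ Define $F_i=\max_{x_i\in[b_i,c_i],\,d\in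 D} f_i(d,x_i)$ for $i=1,\dots,n$ and assume that $$f_j^*+p_{i,j}(F_i-f_i^* )\le a_j\quad\text{for all }i,j=1,\dots,n.$$ Define the matrix $\Gamma=\{\gamma_{i,j}: i,j=1,\dots,n\}$ by $$\gamma_{i,i}:=\lambda_i,\quad i=1,\dots,n,$$ $$\gamma_{i,j}:=\frac{F_i\,p_{i,j}\max(0,c_j-\omega_j)}{\left(f_j^*+p_{i,j}(F_i-f_i^* )\right)(c_j-x_j^* )}+\left(p_{j,i}+\sum_{k=1}^n\frac{F_i\,p_{i,k}\,p_{j,k}}{f_k^*+p_{i,k}(F_i-f_i^* )}\right)\mu_j,\quad i,j=1,\dots,n,\ i\ne j,$$ where the first quotient is read as $0$ if $c_j=x_j^*$ (in which case its numerator vanishes). Suppose that the spectral radius $\rho(\Gamma)$ of $\Gamma$ is less than $1$. Then the equilibrium point $x^*$ is Robustly Globally Exponentially Stable (RGES) for the system.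
   Context: Data of the network. $n$ is the number of components; $a_i>0$ (capacities), $v_i>0$ (attempted external inflows), $p_{i,j}\ge0$ with $p_{i,i}=0$, and $Q_i\ge 0$ are constants with $\sum_{j=1}^n p_{i,j}+Q_i=1$ for every $i=1,\dots,n$. $D$ is a non-empty compact subset of a finite-dimensional Euclidean space and $f_i:D\times[0,a_i]\to\mathbb{R}_+=[0,+\infty)$ are functions with $f_i(d,x_i)\le x_i$ for all $(d,x_i)\in D\times[0,a_i]$. System. On $S=[0,a_1]\times\dots\times[0,a_n]$, with disturbance $d\in D$, the system is, for $i=1,\dots,n$, $$x_i^+=x_i-\left(Q_i+\sum_{j=1}^n\frac{\min\left(a_j-x_j,\ v_j+\sum_{k=1}^n p_{k,j}f_k(d,x_k)\right)}{v_j+\sum_{k=1}^n p_{k,j}f_k(d,x_k)}\,p_{i,j}\right)f_i(d,x_i)+\min\left(a_i-x_i,\ v_i+\sum_{j=1}^n p_{j,i}f_j(d,x_j)\right).$$ For $x_0\in S$ and a sequence $\{d_t\in D\}_{t=0}^\infty$, the corresponding solution $x(t)$ has $x(0)=x_0$ and $x(t+1)$ is obtained from $x(t)$ by the right-hand side with $d=d_t$, $x=x(t)$. Equilibrium assumption. The matrix $P=\{p_{i,j}:i,j=1,\dots,n\}$ satisfies $\det(I-P')\ne0$ (the prime denotes transpose), and there exists $x^*=(x_1^*,\dots,x_n^* )'\in S$ such that for all $d\in D$ and $i=1,\dots,n$: $$v_i+x_i^*+\sum_{j=1}^n p_{j,i}f_j(d,x_j^* )\le a_i,\qquad f_i(d,x_i^*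 )=v_i+\sum_{j=1}^n p_{j,i}f_j(d,x_j^* ).$$ Consequently $f_i(d,x_i^* )$ does not depend on $d$; its value is denoted $f_i^*$, i.e. $f^*=(f_1^*,\dots,f_n^* )'=(I-P')^{-1}v$ with $v=(v_1,\dots,v_n)'$. Trapping region: a set $A\subseteq S$ for which there exists an integer $m\ge0$ such that for every $x_0\in S$ and every $\{d_t\in D\}_{t=0}^\infty$ the corresponding solution satisfies $x(t)\in A$ for all $t\ge m$. RGES: there exist constants $M,\sigma>0$ such that for every $x_0\in S$ and every $\{d_t\in D\}_{t=0}^\infty$ the corresponding solution satisfies $|x(t)-x^*|\le M\exp(-\sigma t)|x_0-x^*|$ for all integers $t\ge0$, where $|\cdot|$ is the Euclidean norm. *)

(* Defs.v *)
From mathcomp Require Import all_boot all_order all_algebra.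
From mathcomp Require Import all_classical all_reals all_analysis.
From mathcomp Require Import complex.

Set Implicit Arguments.
Unset Strict Implicit.
Unset Printing Implicit Defensive.

Import Order.TTheory GRing.Theory Num.Theory.
Import numFieldNormedType.Exports.

Local Open Scope classical_set_scope.
Local Open Scope ring_scope.

(* Euclidean norm; the library norm `|x| on 'rV[R]_n is the sup norm. *)
Definition enorm (R : realType) (n : nat) (x : 'rV[R]_n) : R :=
  Num.sqrt (\sum_(i < n) x 0 i ^+ 2).

Definition is_maximum (R : realType) (B : set R) (m : R) : Prop :=
  B m /\ ubound B m.

(* Largest modulus of a complex eigenvalue of a real matrix. The set is finite,
   and nonempty for n > 0, so sup is a maximum; it is 0 for n = 0. *)
Definition spectral_radius (R : realType) (n : nat) (A : 'M[R]_n) : R :=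
  sup [set ComplexField.Normc.normc z | z in
        [set z : R[i] | eigenvalue (map_mx (real_complex R) A) z]].

(* n is the number of components and q the dimension of the Euclidean space
   that contains the disturbance set. The flows are total functions, but only
   their values on D x [0, a_i] are constrained, and only these are used by
   solutions starting in the state space. *)
Record network (R : realType) (n q : nat) := Network {
  capacity : 'I_n -> R;
  inflow : 'I_n -> R;
  prob : 'M[R]_n;
  exit_rate : 'I_n -> R;
  disturbance : set 'rV[R]_q;
  flow : 'I_n -> 'rV[R]_q -> R -> R;
  capacity_gt0 : forall i, 0 < capacity i;
  inflow_gt0 : forall i, 0 < inflow i;
  prob_ge0 : forall i j, 0 <= prob i j;
  prob_diag : forall i, prob i i = 0;
  exit_rate_ge0 : forall i, 0 <= exit_rate i;
  prob_sum : forall i, \sum_(j < n) prob i j + exit_rate i = 1;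
  disturbance_neq0 : disturbance !=set0;
  disturbance_compact : compact disturbance;
  flow_ge0 : forall i (d : 'rV[R]_q) (x : R), disturbance d -> 0 <= x <= capacity i ->
    0 <= flow i d x;
  flow_le : forall i (d : 'rV[R]_q) (x : R), disturbance d -> 0 <= x <= capacity i ->
    flow i d x <= x }.

Definition box (R : realType) (n : nat) (lo hi : 'I_n -> R) : set 'rV[R]_n :=
  [set x | forall i, lo i <= x 0 i <= hi i].

Section Dynamics.
Variables (R : realType) (n q : nat) (N : network R n q).

Let a := capacity N.
Let v := inflow N.
Let p := prob N.
Let Q := exit_rate N.
Let D := disturbance N.
Let f := flow N.

Definition state_space : set 'rV[R]_n := box (fun=> 0) a.

Definition demand (d : 'rV[R]_q) (x : 'rV[R]_n) (j : 'I_n) : R :=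
  v j + \sum_(k < n) p k j * f k d (x 0 k).

Definition step (d : 'rV[R]_q) (x : 'rV[R]_n) : 'rV[R]_n :=
  \row_(i < n)
    (x 0 i
     - (Q i + \sum_(j < n)
          Num.min (a j - x 0 j) (demand d x j) / demand d x j * p i j)
       * f i d (x 0 i)
     + Num.min (a i - x 0 i) (demand d x i)).

Fixpoint solution (x0 : 'rV[R]_n) (d : nat -> 'rV[R]_q) (t : nat) : 'rV[R]_n :=
  if t is t'.+1 then step (d t') (solution x0 d t') else x0.

(* Under is_equilibrium, f_i(d, xs_i) = eq_flow i for every d in D. *)
Definition eq_flow (i : 'I_n) : R :=
  (invmx (1%:M - p^T) *m (\col_(j < n) v j)) i 0.

Definition is_equilibrium (xs : 'rV[R]_n) : Prop :=
  [/\ \det (1%:M - p^T) != 0,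
      state_space xs,
      (forall d i, D d ->
        v i + xs 0 i + \sum_(j < n) p j i * f j d (xs 0 j) <= a i) &
      (forall d i, D d ->
        f i d (xs 0 i) = v i + \sum_(j < n) p j i * f j d (xs 0 j))].

Definition trapping_region (A : set 'rV[R]_n) : Prop :=
  A `<=` state_space /\
  exists m : nat, forall (x0 : 'rV[R]_n) (d : nat -> 'rV[R]_q),
    state_space x0 -> (forall t, D (d t)) ->
    forall t : nat, (m <= t)%N -> A (solution x0 d t).

Definition RGES (xs : 'rV[R]_n) : Prop :=
  exists M sigma : R, [/\ 0 < M, 0 < sigma &
    forall (x0 : 'rV[R]_n) (d : nat -> 'rV[R]_q),
      state_space x0 -> (forall t, D (d t)) ->
      forall t : nat,
        enorm (solution x0 d t - xs)
          <= M * expR (- (sigma * t%:R)) * enorm (x0 - xs)].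

(* Demand of component j when only component i is away from equilibrium. *)
Definition partial_demand (i j : 'I_n) (d : 'rV[R]_q) (y : R) : R :=
  v j + p i j * f i d y + \sum_(k < n | k != i) p k j * eq_flow k.

(* If c j = xs j, the first quotient is 0, because x / 0 = 0 here. *)
Definition gain_matrix (xs : 'rV[R]_n) (c omega lambda mu F : 'I_n -> R) :
    'M[R]_n :=
  \matrix_(i < n, j < n)
    if i == j then lambda i else
      F i * p i j * Num.max 0 (c j - omega j)
        / ((eq_flow j + p i j * (F i - eq_flow i)) * (c j - xs 0 j))
      + (p j i + \sum_(k < n)
           F i * p i k * p j k / (eq_flow k + p i k * (F i - eq_flow i)))
        * mu j.

End Dynamics.

(* Main.v *)
Require Import Defs.
From mathcomp Require Import all_boot all_order all_algebra.
From mathcomp Require Import all_classical all_reals all_analysis.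
From mathcomp Require Import complex ring lra.

Set Implicit Arguments.
Unset Strict Implicit.
Unset Printing Implicit Defensive.

Import Order.TTheory GRing.Theory Num.Theory.
Import numFieldNormedType.Exports.
Local Open Scope classical_set_scope.
Local Open Scope ring_scope.

(** Put [e_i(t) = |x_i(t) - x*_i|]. Once a trajectory has entered the trapping
    box [A], it satisfies the componentwise linear inequality [e(t+1) <= Gamma
    e(t)] ([step_gain]). As [Gamma] has nonnegative entries
    ([gain_matrix_ge0]), iteration gives [e(m+t) <= Gamma^t e(m)], and the
    powers of a matrix of spectral radius below 1 decay geometrically
    ([linear_comparison_decay]). Before the entrance time [m], which is the
    same for all trajectories, the error is multiplied at each step by at most
    a fixed constant ([step_expansion]), so the transient only costs a
    constant factor ([exponential_decay_after_transient]).

    The inequality [e(t+1) <= Gamma e(t)] comes from splitting the error of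
    component [i] in three. With every other component at equilibrium, except
    that the free space [a_j - x_j] is replaced by [a_j - min(x_j, omega_j)],
    the error is at most [lambda_i e_i] by assumption: [theta_j] is chosen so
    that [theta_j omega_j = min(x_j, omega_j)]. Replacing the equilibrium
    inflow into [i] by the true one costs at most [sum_j p_ji mu_j e_j].
    Finally the fraction [min(s,u)/u] of the outflow accepted by [j] must be
    corrected, both in its supply [s] ([served_fraction_supply], [excess_le])
    and in its demand [u] ([served_fraction_demand]). Each correction carries
    a factor [f_i / u], where [u] is an affine function of [f_i] with positive
    constant term; this quotient is largest at [f_i = F_i] ([flow_share_le]),
    which is where the denominators of [Gamma] come from.

    Geometric decay of [Gamma^t] uses Cayley-Hamilton over the complex
    numbers: the product of the factors [Gamma - z] over the roots [z] of the
    characteristic polynomial vanishes, and the factors are removed one at a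
    time, each by a scalar recurrence. *)

(** * Powers of a matrix of spectral radius below one *)

Lemma normc_ge0 (R : rcfType) (z : R[i]) : 0 <= ComplexField.Normc.normc z.
Proof. by case: z => x y; rewrite sqrtr_ge0. Qed.

(** The forcing term [C r^k] has a strictly larger rate than the free decay
    [z], so [M r^k] is a supersolution as soon as [C <= M (r - z)]. *)
Lemma geometric_bound_of_recurrence (R : realFieldType) (u : nat -> R)
    (z r C : R) :
  0 <= z < r -> 0 <= C -> (forall k, u k.+1 <= z * u k + C * r ^+ k) ->
  forall k, u k <= Num.max (u 0%N) (C / (r - z)) * r ^+ k.
Proof.
move=> /andP[z0 zr] C0 hu; set M := Num.max _ _.
have rz : 0 < r - z by rewrite subr_gt0.
have CM : C <= M * (r - z) by rewrite -ler_pdivrMr// le_max lexx orbT.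
elim=> [|k IH]; first by rewrite expr0 mulr1 le_max lexx.
apply: (le_trans (hu k)).
have rk : 0 <= r ^+ k by rewrite exprn_ge0// (le_trans z0)// ltW.
have h1 : z * u k <= z * (M * r ^+ k) by rewrite ler_wpM2l.
have h2 : C * r ^+ k <= M * (r - z) * r ^+ k by rewrite ler_wpM2r.
rewrite exprS; apply: (le_trans (lerD h1 h2)).
by rewrite le_eqVlt; apply/orP; left; apply/eqP; ring.
Qed.

(** Induction on the factors: if [(A - z) B] has decaying images under the
    powers of [A], then [A^(k+1) B = z A^k B + A^k (A - z) B] is a recurrence
    with contraction [|z| < r] and a forcing term of rate [r]. Quantifying
    over [B] lets the last factor be absorbed into [B], so that neither
    diagonalization nor a normal form is involved. *)
Lemma annihilated_powers_decay (R : rcfType) (n : nat) (A : 'M[R[i]]_n.+1)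
    (r : R) (s : seq R[i]) :
  (forall z, z \in s -> ComplexField.Normc.normc z < r) ->
  forall B : 'M[R[i]]_n.+1, \prod_(z <- s) (A - z%:M) * B = 0 ->
  exists2 C : R, 0 <= C &
    forall k i j, ComplexField.Normc.normc ((A ^+ k * B) i j) <= C * r ^+ k.
Proof.
elim/last_ind: s => [_ B|s z IH hs B].
  rewrite big_nil mul1r => ->; exists 0 => // k i j.
  by rewrite mulr0 mxE ComplexField.Normc.normc0 mul0r.
rewrite big_rcons/= -mulrA => /IH[].
  by move=> y ys; apply: hs; rewrite mem_rcons inE ys orbT.
move=> C C0 hC.
have zr : 0 <= ComplexField.Normc.normc z < r.
  by rewrite normc_ge0 hs// mem_rcons mem_head.
pose u k i j := ComplexField.Normc.normc ((A ^+ k * B) i j).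
have hu i j k : u k.+1 i j <= ComplexField.Normc.normc z * u k i j + C * r ^+ k.
  have split : A ^+ k.+1 * B = z *: (A ^+ k * B) + A ^+ k * ((A - z%:M) * B).
    rewrite mulrBl mulrBr exprSr -mulrA.
    rewrite (mul_scalar_mx z B : z%:M * B = _).
    by rewrite -scalerAr addrC subrK.
  rewrite /u split mxE [X in X + _]mxE.
  apply: (le_trans (le_normcD _ _)); rewrite ComplexField.Normc.normcM.
  by rewrite lerD2l hC.
pose M i j := Num.max (u 0%N i j) (C / (r - ComplexField.Normc.normc z)).
have M0 i j : 0 <= M i j by rewrite le_max normc_ge0.
exists (\sum_i \sum_j M i j); first by do 2 apply: sumr_ge0 => ? _.
move=> k i j.
have := @geometric_bound_of_recurrence R (fun t => u t i j) _ _ _ zr C0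
  (hu i j) k.
move/le_trans; apply.
have rk : 0 <= r ^+ k.
  by rewrite exprn_ge0//; case/andP: zr => z0 /ltW; apply: le_trans.
rewrite ler_wpM2r// (bigD1 i)//= (bigD1 j)//= -addrA lerDl.
by rewrite addr_ge0//; repeat (apply: sumr_ge0 => ? _).
Qed.

(** The supremum is that of a bounded set: the eigenvalues are the finitely
    many roots of the characteristic polynomial, and the sum of their moduli
    bounds each of them. *)
Lemma eigenvalue_le_spectral_radius (R : realType) (n : nat) (A : 'M[R]_n)
    (z : R[i]) :
  eigenvalue (map_mx (real_complex R) A) z ->
  ComplexField.Normc.normc z <= spectral_radius A.
Proof.
move=> hz; apply: ub_le_sup; last by exists z.
have [s hs] := closed_field_poly_normal (char_poly (map_mx (real_complex R) A)).
exists (\sum_(y <- s) ComplexField.Normc.normc y) => _ [y /= hy <-].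
have ys : y \in s.
  move: hy; rewrite eigenvalue_root_char hs (monicP (char_poly_monic _)).
  by rewrite scale1r root_prod_XsubC.
rewrite (perm_big _ (perm_to_rem ys)) big_cons lerDl.
by apply: sumr_ge0 => w _; rewrite normc_ge0.
Qed.

Lemma spectral_radius_powers_decay (R : realType) (n : nat) (A : 'M[R]_n.+1) :
  spectral_radius A < 1 ->
  exists C r : R, [/\ 0 <= C, 0 < r < 1 &
    forall k i j, `|(A ^+ k) i j| <= C * r ^+ k].
Proof.
move=> hA; pose AC := map_mx (real_complex R) A.
(* A rate strictly between the spectral radius and 1; the maximum with 0 makes
   it positive. *)
pose r := (1 + Num.max 0 (spectral_radius A)) / 2.
have m0 : 0 <= Num.max 0 (spectral_radius A) by rewrite le_max lexx.
have m1 : Num.max 0 (spectral_radius A) < 1 by rewrite gt_max ltr01.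
have ms : spectral_radius A <= Num.max 0 (spectral_radius A).
  by rewrite le_max lexx orbT.
have [s hs] := closed_field_poly_normal (char_poly AC).
rewrite (monicP (char_poly_monic _)) scale1r in hs.
have hsr z : z \in s -> ComplexField.Normc.normc z < r.
  move=> zs; have /eigenvalue_le_spectral_radius : eigenvalue AC z.
    by rewrite eigenvalue_root_char hs root_prod_XsubC.
  by move=> h; rewrite /r; lra.
have kill : \prod_(z <- s) (AC - z%:M) * 1 = 0.
  rewrite mulr1 -(Cayley_Hamilton AC) hs rmorph_prod; apply: eq_bigr => z _.
  by rewrite rmorphB /= horner_mx_X horner_mx_C.
have [C C0 hC] := annihilated_powers_decay hsr kill.
exists C, r; split=> //; first by rewrite /r; lra.
move=> k i j; have := hC k i j; rewrite mulr1 /AC -rmorphXn mxE.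
by rewrite /= expr0n/= addr0 sqrtr_sqr.
Qed.

(** Nonnegative entries make [A] monotone, so the inequality [e(t+1) <= A
    e(t)] can be iterated to [e(t) <= A^t e(0)]. *)
Lemma linear_comparison_decay (R : realType) (n : nat) (A : 'M[R]_n) :
  (forall i j, 0 <= A i j) -> spectral_radius A < 1 ->
  exists C r : R, [/\ 0 <= C, 0 < r < 1 &
    forall e : nat -> 'I_n -> R, (forall i, 0 <= e 0%N i) ->
      (forall t i, e t.+1 i <= \sum_j A i j * e t j) ->
      forall t, \sum_i e t i <= C * r ^+ t * \sum_i e 0%N i].
Proof.
case: n A => [A _ _|n A A0 /spectral_radius_powers_decay[C [r [C0 r01 hC]]]].
  exists 0, 2^-1; split=> //; first lra.
  by move=> e _ _ t; rewrite !big_ord0 mulr0.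
exists (n.+1%:R * C), r; split=> [||e e0 he t]; rewrite ?mulr_ge0//.
have hpow : forall i, e t i <= \sum_j (A ^+ t) i j * e 0%N j.
  elim: t => [|t IH] i.
    rewrite (bigD1 i)//= big1 => [|j /negPf ji].
      by rewrite mxE eqxx mul1r addr0.
    by rewrite mxE eq_sym ji mul0r.
  apply: (le_trans (he t i)).
  have -> : \sum_j (A ^+ t.+1) i j * e 0%N j
      = \sum_k A i k * \sum_j (A ^+ t) k j * e 0%N j.
    under eq_bigr do rewrite exprS mxE mulr_suml.
    rewrite exchange_big/=; apply: eq_bigr => k _; rewrite mulr_sumr.
    by apply: eq_bigr => j _; rewrite mulrA.
  by apply: ler_sum => k _; rewrite ler_wpM2l.
apply: (@le_trans _ _ (\sum_(i < n.+1) C * r ^+ t * \sum_j e 0%N j)).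
  apply: ler_sum => i _; apply: (le_trans (hpow i)); rewrite mulr_sumr.
  by apply: ler_sum => j _; rewrite ler_wpM2r// (le_trans (ler_norm _)).
by rewrite sumr_const card_ord -!mulrA mulr_natl.
Qed.

(** * Perturbation of the accepted fraction of a demand *)

Lemma le_norm_min_sub (R : realDomainType) (s s' u u' : R) :
  `|Num.min s u - Num.min s' u'| <= `|s - s'| + `|u - u'|.
Proof.
have [h1 h2] : - `|s - s'| <= s - s' /\ s - s' <= `|s - s'|.
  by apply/andP; rewrite -ler_norml.
have [h3 h4] : - `|u - u'| <= u - u' /\ u - u' <= `|u - u'|.
  by apply/andP; rewrite -ler_norml.
by rewrite ler_norml; case: (leP s u); case: (leP s' u') => ? ?;
  apply/andP; split; lra.
Qed.

Lemma served_fraction_supply (R : realFieldType) (s s' u : R) : 0 < u ->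
  `|Num.min s u / u - Num.min s' u / u| <= `|s - s'| / u.
Proof.
move=> u0; rewrite -mulrBl normrM (gtr0_norm (x := u^-1)) ?invr_gt0//.
rewrite ler_pM2r ?invr_gt0//; apply: le_trans (le_norm_min_sub _ _ _ _) _.
by rewrite subrr normr0 addr0.
Qed.

(** The fraction is 1 for [u <= s] and [s/u] beyond, so the ratio of its
    values at [u] and [w] lies between 1 and [u/w]; since both values are at
    most 1, they differ by at most [|w - u| / max(u, w)]. *)
Lemma served_fraction_demand (R : realFieldType) (s u w : R) :
  0 <= s -> 0 < u -> 0 < w ->
  `|Num.min s u / u - Num.min s w / w| <= `|w - u| / u.
Proof.
move=> s0 u0 w0; rewrite ler_pdivlMr//.
set X := Num.min s w / w; set Y := Num.min s u / u.
have hX : Num.min s w = X * w by rewrite divfK// gt_eqF.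
have hY : Num.min s u = Y * u by rewrite divfK// gt_eqF.
have X1 : 0 <= X <= 1.
  apply/andP; split.
    by apply: divr_ge0; rewrite ?le_min ?s0 (ltW w0).
  by rewrite ler_pdivrMr// mul1r ge_min lexx orbT.
rewrite -[X in _ * X](gtr0_norm u0) -normrM mulrBl -hY.
(* The two summands have opposite signs and, as [X <= 1], each is at most
   [|w - u|] in absolute value. *)
have -> : Num.min s u - X * u = X * (w - u) + (Num.min s u - Num.min s w).
  by rewrite hX; ring.
move: X1 hX => /andP[]; move: (X) => X' X0 X1.
case: (leP s w) => sw; case: (leP s u) => su hX.
- by rewrite subrr addr0 normrM ger0_norm// ler_piMl.
- have uw : 0 <= w - u by lra.
  rewrite (ger0_norm uw) ler_norml; apply/andP; split; nra.
- have -> : X' = 1 by nra.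
  by rewrite ler_norml; case: (ler0P (w - u)) => ?; apply/andP; split; lra.
- have -> : X' = 1 by nra.
  by rewrite mul1r addrA subrK subrr normr0.
Qed.

Lemma ratio_affine_mono (R : realFieldType) (A p y F : R) :
  0 < A -> 0 <= p -> 0 <= y <= F -> y / (A + p * y) <= F / (A + p * F).
Proof.
move=> A0 p0 /andP[y0 yF]; have F0 := le_trans y0 yF.
rewrite ler_pdivrMr ?ltr_wpDr ?mulr_ge0// mulrAC ler_pdivlMr.
  nra.
by rewrite ltr_wpDr ?mulr_ge0.
Qed.

(** The function [x |-> (x - om) / (x - z)] is increasing to the right of [om
    >= z], so it is largest at [x = c]; to the left of [om] there is no
    excess. *)
Lemma excess_le (R : realFieldType) (x z om c : R) : z <= om -> x <= c ->
  x - Num.min x om <= Num.max 0 (c - om) / (c - z) * `|x - z|.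
Proof.
move=> zom xc; have rhs0 : 0 <= Num.max 0 (c - om) / (c - z) * `|x - z|.
  rewrite mulr_ge0//; case: (leP 0 (c - om)) => h; last by rewrite mul0r.
  by rewrite divr_ge0//; lra.
case: (leP x om) => xom; first by rewrite subrr.
rewrite max_r ?gtr0_norm; [|lra|lra].
rewrite mulrAC ler_pdivlMr; last lra.
nra.
Qed.

(** * The network at and near equilibrium *)

Section Equilibrium.
Variables (R : realType) (n q : nat) (N : network R n q) (xs : 'rV[R]_n).
Hypothesis hxs : is_equilibrium N xs.

Let a := capacity N.
Let v := inflow N.
Let p := prob N.
Let f := flow N.
Let fs := eq_flow N.

(** The equilibrium equations form the linear system [(I - P') g = v], which
    has only one solution. *)
Lemma flow_at_equilibrium i d : disturbance N d -> f i d (xs 0 i) = fs i.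
Proof.
case: hxs => hdet _ _ hf hd.
pose g := \col_i f i d (xs 0 i).
have hg : (1%:M - p^T) *m g = \col_i v i.
  apply/colP => j; rewrite mulmxBl mul1mx !mxE /f hf//.
  by under [X in _ - X]eq_bigr do rewrite !mxE; rewrite addrK.
rewrite /fs /eq_flow -hg mulmxA mulVmx ?mul1mx ?mxE//.
by rewrite unitmxE unitfE.
Qed.

Lemma eq_flow_ge0 i : 0 <= fs i.
Proof.
have [d hd] := disturbance_neq0 N; rewrite -(flow_at_equilibrium i hd).
by case: hxs => _ hS _ _; apply: flow_ge0.
Qed.

Lemma eq_flow_balance i : fs i = v i + \sum_j p j i * fs j.
Proof.
have [d hd] := disturbance_neq0 N; rewrite -(flow_at_equilibrium i hd).
case: hxs => _ _ _ hf; rewrite /f hf//; congr (_ + _); apply: eq_bigr => j _.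
by rewrite -(flow_at_equilibrium j hd).
Qed.

Lemma eq_flow_le_free i : fs i <= a i - xs 0 i.
Proof.
have [d hd] := disturbance_neq0 N; rewrite -(flow_at_equilibrium i hd).
by case: hxs => _ _ /(_ d i hd) h hf; rewrite /f hf// /a; lra.
Qed.

(** Keeps the demands of the gain matrix positive: removing the equilibrium
    contribution of [i] from the inflow of [j] leaves at least [v_j]. *)
Lemma eq_flow_ge_inflow_add i j : v j + p i j * fs i <= fs j.
Proof.
rewrite [fs j]eq_flow_balance lerD2l (bigD1 i)//= lerDl.
by apply: sumr_ge0 => k _; rewrite mulr_ge0 ?prob_ge0 ?eq_flow_ge0.
Qed.

Lemma eq_flow_gt0 i : 0 < fs i.
Proof.
apply: lt_le_trans (eq_flow_ge_inflow_add i i).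
by rewrite prob_diag mul0r addr0 inflow_gt0.
Qed.

Lemma prob_le1 i j : p i j <= 1.
Proof.
rewrite -(prob_sum N i) (bigD1 j)//= -addrA lerDl addr_ge0 ?exit_rate_ge0//.
by apply: sumr_ge0 => k _; apply: prob_ge0.
Qed.

Lemma demand_gt0 d x j : disturbance N d -> state_space N x ->
  0 < demand N d x j.
Proof.
move=> hd hx; rewrite ltr_wpDr ?inflow_gt0//; apply: sumr_ge0 => k _.
by rewrite mulr_ge0 ?prob_ge0// flow_ge0.
Qed.

Lemma demand_sub_eq_flow d x j :
  demand N d x j - fs j = \sum_k p k j * (f k d (x 0 k) - fs k).
Proof.
rewrite eq_flow_balance opprD addrACA subrr add0r -sumrB.
by apply: eq_bigr => k _; rewrite mulrBr.
Qed.

Lemma partial_demandE d i j y :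
  partial_demand N i j d y = fs j + p i j * (f i d y - fs i).
Proof.
rewrite [fs j]eq_flow_balance /partial_demand -/p -/v -/f -/fs.
by rewrite [X in _ = _ + X + _](bigD1 i)//=; ring.
Qed.

Lemma demand_sub_partial d x i j :
  demand N d x j - partial_demand N i j d (x 0 i)
  = \sum_(k | k != i) p k j * (f k d (x 0 k) - fs k).
Proof.
rewrite partial_demandE opprD addrA demand_sub_eq_flow (bigD1 i)//=.
by rewrite addrAC subrr add0r.
Qed.

Lemma outgoing_fraction d x i : disturbance N d -> state_space N x ->
  0 <= exit_rate N i + \sum_j Num.min (a j - x 0 j) (demand N d x j)
                         / demand N d x j * p i j <= 1.
Proof.
move=> hd hx; have w0 j := demand_gt0 j hd hx.
have frac j : 0 <= Num.min (a j - x 0 j) (demand N d x j) / demand N d x j <= 1.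
  apply/andP; split.
    apply: divr_ge0; last exact/ltW.
    by rewrite le_min subr_ge0 (ltW (w0 j)) andbT; case/andP: (hx j).
  by rewrite ler_pdivrMr// mul1r ge_min lexx orbT.
apply/andP; split.
  rewrite addr_ge0 ?exit_rate_ge0// sumr_ge0// => j _.
  by rewrite mulr_ge0 ?prob_ge0//; case/andP: (frac j).
rewrite -(prob_sum N i) addrC lerD2r; apply: ler_sum => j _.
by apply: ler_piMl; [exact: prob_ge0|case/andP: (frac j)].
Qed.

(** A component loses at most its outflow, which is at most its content, and
    gains at most its free space. *)
Lemma step_state_space d x : disturbance N d -> state_space N x ->
  state_space N (step N d x).
Proof.
move=> hd hx i; rewrite mxE -/a -/p.
have /andP[g0 g1] := outgoing_fraction i hd hx.
have /andP[x0 xa] := hx i.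
have f0 := flow_ge0 hd (hx i); have fx := flow_le hd (hx i).
set o := exit_rate N i + _; move: g0 g1; rewrite -/o => g0 g1.
have m0 : 0 <= Num.min (a i - x 0 i) (demand N d x i).
  by rewrite le_min subr_ge0 xa ltW// demand_gt0.
have ma : Num.min (a i - x 0 i) (demand N d x i) <= a i - x 0 i.
  by rewrite ge_min lexx.
have g2 : o * flow N i d (x 0 i) <= flow N i d (x 0 i) by apply: ler_piMl.
have g3 : 0 <= o * flow N i d (x 0 i) by rewrite mulr_ge0.
by rewrite -/a; apply/andP; split; lra.
Qed.

Lemma solution_state_space x0 d t : state_space N x0 ->
  (forall t, disturbance N (d t)) -> state_space N (solution N x0 d t).
Proof.
by move=> hx hd; elim: t => [//|t IH] /=; apply: step_state_space.
Qed.

(** At equilibrium everything is accepted, so 1 is the accepted fraction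
    there; both the supply and the demand are then perturbed with the fixed
    denominator [f*_j], which avoids any lower bound on the current demand. *)
Lemma served_fraction_sub1 d x j : disturbance N d -> state_space N x ->
  `|Num.min (a j - x 0 j) (demand N d x j) / demand N d x j - 1|
  <= (`|x 0 j - xs 0 j| + `|demand N d x j - fs j|) / fs j.
Proof.
move=> hd hx; have f0 := eq_flow_gt0 j.
have -> : 1 = Num.min (a j - xs 0 j) (fs j) / fs j.
  by rewrite min_r ?eq_flow_le_free// divff ?gt_eqF.
rewrite mulrDl [X in _ <= X]addrC.
rewrite -(subrKA (Num.min (a j - x 0 j) (fs j) / fs j)).
apply: (le_trans (ler_normD _ _)); apply: lerD.
  rewrite distrC; apply: served_fraction_demand => //; last exact: demand_gt0.
  by rewrite subr_ge0; case/andP: (hx j).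
apply: le_trans (served_fraction_supply _ _ f0) _.
by rewrite opprB addrCA addrAC subrr add0r distrC.
Qed.

Variable L : R.
Hypothesis hL : 0 <= L.
Hypothesis hfL : forall i (d : 'rV[R]_q) (x : R),
  disturbance N d -> 0 <= x <= a i -> `|f i d x - fs i| <= L * `|x - xs 0 i|.

(** A Lipschitz bound at the equilibrium only, valid on the whole state space:
    it controls the trajectory before it enters the trapping box. *)
Lemma step_expansion : exists K : R, 1 <= K /\
  forall d x, disturbance N d -> state_space N x ->
  \sum_i `|step N d x 0 i - xs 0 i| <= K * \sum_i `|x 0 i - xs 0 i|.
Proof.
pose T := \sum_j (fs j)^-1.
pose K i := 1 + L + ((1 + L) * T * fs i + (1 + L)).
have T0 : 0 <= T by apply: sumr_ge0 => j _; rewrite invr_ge0 eq_flow_ge0.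
have K0 i : 0 <= K i.
  have L1 := addr_ge0 ler01 hL.
  by rewrite /K !addr_ge0// !mulr_ge0// eq_flow_ge0.
exists (1 + \sum_i K i); split; first by rewrite lerDl sumr_ge0.
move=> d x hd hx; set E := \sum_i `|x 0 i - xs 0 i|.
have E0 : 0 <= E by apply: sumr_ge0.
have eE j : `|x 0 j - xs 0 j| <= E.
  by rewrite /E (bigD1 j)//= lerDl; apply: sumr_ge0.
have fE j : `|f j d (x 0 j) - fs j| <= L * E.
  by apply: le_trans (hfL hd (hx j)) _; rewrite ler_wpM2l.
have wE j : `|demand N d x j - fs j| <= L * E.
  rewrite demand_sub_eq_flow; apply: le_trans (ler_norm_sum _ _ _) _.
  rewrite /E mulr_sumr; apply: ler_sum => k _.
  rewrite normrM (ger0_norm (prob_ge0 _ _ _)).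
  by apply: le_trans (ler_piMl _ (prob_le1 k j)) _ => //; apply: hfL.
suff hi i : `|step N d x 0 i - xs 0 i| <= K i * E.
  rewrite mulrDl mul1r mulr_suml ler_wpDl//; exact: ler_sum.
have /andP[g0 g1] := outgoing_fraction i hd hx.
rewrite mxE -/a -/p -/f.
pose h j := Num.min (a j - x 0 j) (demand N d x j) / demand N d x j.
set o := exit_rate N i + _; move: g0 g1; rewrite -/o => g0 g1.
have osub : o - 1 = \sum_j (h j - 1) * p i j.
  under eq_bigr do rewrite mulrBl mul1r.
  by rewrite sumrB -[X in _ - X](prob_sum N i) /o; ring.
have oE : `|o - 1| <= (1 + L) * T * E.
  rewrite osub; apply: le_trans (ler_norm_sum _ _ _) _.
  rewrite mulrAC mulr_sumr; apply: ler_sum => j _.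
  rewrite normrM (ger0_norm (prob_ge0 _ _ _)).
  apply: le_trans (ler_piMr _ (prob_le1 i j)) _ => //.
  apply: le_trans (served_fraction_sub1 j hd hx) _.
  rewrite ler_wpM2r ?invr_ge0 ?eq_flow_ge0//.
  by rewrite mulrDl mul1r lerD.
have mE : `|Num.min (a i - x 0 i) (demand N d x i) - fs i| <= (1 + L) * E.
  rewrite -[X in _ - X](min_r (eq_flow_le_free i)).
  apply: le_trans (le_norm_min_sub _ _ _ _) _; rewrite mulrDl mul1r lerD//.
  by rewrite opprB addrCA addrAC subrr add0r distrC.
have -> : x 0 i - o * f i d (x 0 i)
      + Num.min (a i - x 0 i) (demand N d x i) - xs 0 i
    = (x 0 i - xs 0 i) - o * (f i d (x 0 i) - fs i)
      + (- ((o - 1) * fs i)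
         + (Num.min (a i - x 0 i) (demand N d x i) - fs i)) by ring.
rewrite /K [X in _ <= X]mulrDl; apply: le_trans (ler_normD _ _) _; apply: lerD.
  rewrite [X in _ <= X]mulrDl mul1r; apply: le_trans (ler_normB _ _) _.
  apply: lerD => //.
  by rewrite normrM (ger0_norm g0); apply: le_trans (ler_piMl _ g1) _.
rewrite [X in _ <= X]mulrDl; apply: le_trans (ler_normD _ _) _; apply: lerD => //.
rewrite normrN normrM (ger0_norm (eq_flow_ge0 i)) mulrAC.
by rewrite ler_wpM2r ?eq_flow_ge0.
Qed.

(** * The gain inequality in the trapping box *)

Variables (b c lambda mu omega F : 'I_n -> R).
Hypothesis hbc : forall i, 0 <= b i /\ b i < c i /\ c i <= a i.
Hypothesis hlambda : forall i, 0 <= lambda i.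
Hypothesis hmu : forall i, 0 <= mu i.
Hypothesis homega : forall i, xs 0 i <= omega i < a i.
Hypothesis hflambda : forall i (d : 'rV[R]_q) (x : R) (theta : 'I_n -> R),
  disturbance N d -> b i <= x <= c i -> (forall j, 0 <= theta j <= 1) ->
  `| x - xs 0 i
     - (exit_rate N i + \sum_(j < n)
          Num.min (a j - theta j * omega j) (partial_demand N i j d x)
            / partial_demand N i j d x * p i j) * f i d x
     + Num.min (a i - x) (v i + \sum_(j < n) p j i * fs j) |
  <= lambda i * `|x - xs 0 i|.
Hypothesis hfmu : forall i (d : 'rV[R]_q) (x : R),
  disturbance N d -> b i <= x <= c i -> `|fs i - f i d x| <= mu i * `|x - xs 0 i|.
Hypothesis hF : forall i, is_maximum
  [set f i d x | d in disturbance N & x in (`[b i, c i] : set R)] (F i).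

Let Gamma := gain_matrix N xs c omega lambda mu F.
Let den i j := fs j + p i j * (F i - fs i).

Lemma box_capacity i y : b i <= y <= c i -> 0 <= y <= a i.
Proof.
have [b0 [_ ca]] := hbc i; case/andP => by_ yc.
by rewrite (le_trans b0 by_) (le_trans yc ca).
Qed.

Lemma box_state_space x : box b c x -> state_space N x.
Proof. by move=> hx i; apply: box_capacity. Qed.

Lemma flow_le_max i d y : disturbance N d -> b i <= y <= c i -> f i d y <= F i.
Proof.
move=> hd hy; have [_ ub] := hF i; apply: ub; by exists d => //; exists y.
Qed.

Lemma max_flow_ge0 i : 0 <= F i.
Proof.
have [[d hd [y hy <-]] _] := hF i; apply: flow_ge0 => //.
by apply: box_capacity; rewrite /= in_itv in hy.
Qed.

Lemma affine_demand_gt0 i j y : 0 <= y -> 0 < fs j + p i j * (y - fs i).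
Proof.
move=> y0; have h := eq_flow_ge_inflow_add i j; have v0 := inflow_gt0 N j.
have py := mulr_ge0 (prob_ge0 N i j) y0; rewrite mulrBr -/p in py *.
by rewrite -/v in v0; lra.
Qed.

(** Written as [A + p_ij y] with [A = f*_j - p_ij f*_i > 0], the denominator
    makes the quotient increasing in [y]. *)
Lemma flow_share_le i j y : 0 <= y <= F i ->
  y / (fs j + p i j * (y - fs i)) <= F i / den i j.
Proof.
move=> hy; have h z : fs j + p i j * (z - fs i) = fs j - p i j * fs i + p i j * z.
  by ring.
rewrite /den !h; apply: ratio_affine_mono; rewrite ?prob_ge0//.
have := affine_demand_gt0 i j (lexx 0); rewrite h mulr0 addr0; exact.
Qed.

(** If [c_j > omega_j], then also [c_j > x*_j], so the first quotient has a
    positive denominator whenever its numerator is nonzero. *)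
Lemma gain_matrix_ge0 i j : 0 <= Gamma i j.
Proof.
rewrite mxE; case: eqP => // _.
have F0 := max_flow_ge0 i.
have den0 k := affine_demand_gt0 i k F0.
apply: addr_ge0.
  have [h|h] := leP (c j - omega j) 0.
    by rewrite mulr0 mul0r.
  have := homega j => /andP[xo _].
  apply: divr_ge0; first by rewrite !mulr_ge0 ?prob_ge0// ltW.
  by rewrite mulr_ge0//; [exact/ltW/den0|lra].
apply: mulr_ge0 => //; apply: addr_ge0; first exact: prob_ge0.
apply: sumr_ge0 => k _; apply: divr_ge0; last exact/ltW/den0.
by rewrite !mulr_ge0 ?prob_ge0.
Qed.

(** The three-term splitting of the error of component [i] described at the
    top. No correction involves [e_i]: [p_ii = 0], and the demand of the first
    term already contains the true flow of [i]. Hence the diagonal of the gain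
    matrix is [lambda_i] alone. *)
Lemma step_gain d x i : disturbance N d -> box b c x ->
  `|step N d x 0 i - xs 0 i| <= \sum_j Gamma i j * `|x 0 j - xs 0 j|.
Proof.
move=> hd hx; have hS := box_state_space hx.
pose e j := `|x 0 j - xs 0 j|; rewrite -/(e _).
pose w j := demand N d x j; pose u j := partial_demand N i j d (x 0 i).
pose y := f i d (x 0 i).
have y0 : 0 <= y by apply: flow_ge0.
have yF : y <= F i by apply: flow_le_max.
have uE j : u j = fs j + p i j * (y - fs i) by apply: partial_demandE.
have u0 j : 0 < u j by rewrite uE affine_demand_gt0.
have w0 j : 0 < w j by apply: demand_gt0.
have xs0 j : 0 <= xs 0 j by case: hxs => _ hS' _ _; case/andP: (hS' j).
have e0 j : 0 <= e j by exact: normr_ge0.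
(* If [omega j = 0], the quotient is 0, which is consistent with
   [theta j * omega j = min(x_j, omega_j)] since [x_j >= 0]. *)
pose theta j := Num.min (x 0 j) (omega j) / omega j.
have omega0 j : 0 <= omega j by case/andP: (homega j) => h _; apply: le_trans h.
have x0 j : 0 <= x 0 j by case/andP: (hS j).
have m0 j : 0 <= Num.min (x 0 j) (omega j) by rewrite le_min x0 omega0.
have thetaE j : theta j * omega j = Num.min (x 0 j) (omega j).
  rewrite /theta; have [om0|om0] := eqVneq (omega j) 0; last by rewrite divfK.
  by rewrite om0 mulr0 min_r.
have theta01 j : 0 <= theta j <= 1.
  rewrite divr_ge0//=; have [om0|om0] := eqVneq (omega j) 0.
    by rewrite /theta om0 invr0 mulr0.
  by rewrite ler_pdivrMr ?lt_def ?om0 ?omega0// mul1r ge_min lexx orbT.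
pose g j := Num.min (a j - theta j * omega j) (u j) / u j.
pose h j := Num.min (a j - x 0 j) (w j) / w j.
have /= hT1 := hflambda hd (hx i) theta01.
rewrite -/(e i) -/y -eq_flow_balance in hT1.
have flowE k : `|f k d (x 0 k) - fs k| <= mu k * e k.
  by rewrite distrC; apply: hfmu.
have hT2 : `|Num.min (a i - x 0 i) (w i) - Num.min (a i - x 0 i) (fs i)|
    <= \sum_(j | j != i) p j i * mu j * e j.
  apply: le_trans (le_norm_min_sub _ _ _ _) _.
  rewrite subrr normr0 add0r demand_sub_eq_flow (bigD1 i)//=.
  rewrite [p i i]prob_diag mul0r add0r; apply: le_trans (ler_norm_sum _ _ _) _.
  apply: ler_sum => j _; rewrite normrM (ger0_norm (prob_ge0 _ _ _)) -mulrA.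
  by apply: ler_wpM2l; [exact: prob_ge0|exact: flowE].
pose ex j := Num.max 0 (c j - omega j) / (c j - xs 0 j) * e j.
have hgh j :
  `|g j - h j| <= (ex j + \sum_(k | k != i) p k j * mu k * e k) / u j.
  rewrite -(subrKA (Num.min (a j - x 0 j) (u j) / u j)).
  apply: (le_trans (ler_normD _ _)); rewrite [X in _ <= X]mulrDl; apply: lerD.
    apply: le_trans (served_fraction_supply _ _ (u0 j)) _.
    rewrite ler_pM2r ?invr_gt0// opprB addrCA addrAC subrr add0r thetaE.
    rewrite ger0_norm ?subr_ge0 ?ge_min ?lexx//.
    apply: excess_le; first by case/andP: (homega j).
    by case/andP: (hx j).
  apply: le_trans (served_fraction_demand _ (u0 j) (w0 j)) _.
    by rewrite subr_ge0; case/andP: (hS j).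
  rewrite ler_pM2r ?invr_gt0// demand_sub_partial.
  apply: le_trans (ler_norm_sum _ _ _) _.
  apply: ler_sum => k _; rewrite normrM (ger0_norm (prob_ge0 _ _ _)) -mulrA.
  by apply: ler_wpM2l; [exact: prob_ge0|exact: flowE].
have ex0 j : 0 <= ex j.
  apply: le_trans (excess_le _ _); last by case/andP: (hx j) => _; apply.
    by rewrite subr_ge0 ge_min lexx.
  by case/andP: (homega j).
have hT3 : `|(\sum_j (g j - h j) * p i j) * y|
    <= \sum_j F i / den i j * p i j * ex j
       + \sum_(k | k != i) (\sum_j F i * p i j * p k j / den i j) * mu k * e k.
  have -> : \sum_(k | k != i) (\sum_j F i * p i j * p k j / den i j) * mu k * e k
      = \sum_j F i / den i j * p i j * \sum_(k | k != i) p k j * mu k * e k.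
    under eq_bigr do rewrite 2!mulr_suml.
    rewrite exchange_big/=; apply: eq_bigr => j _; rewrite mulr_sumr.
    by apply: eq_bigr => k _; ring.
  rewrite -big_split/= mulr_suml; apply: le_trans (ler_norm_sum _ _ _) _.
  apply: ler_sum => j _; rewrite -mulrDr !normrM (ger0_norm y0).
  rewrite (ger0_norm (prob_ge0 _ _ _)).
  set Z := ex j + _.
  have Z0 : 0 <= Z.
    rewrite addr_ge0// sumr_ge0// => k _.
    by rewrite !mulr_ge0 ?prob_ge0.
  have hyu : y / u j <= F i / den i j by rewrite uE flow_share_le ?y0.
  apply: (@le_trans _ _ (Z / u j * p i j * y)).
    rewrite -/p; apply: ler_wpM2r => //; apply: ler_wpM2r.
      exact: prob_ge0.
    exact: hgh.
  rewrite [leLHS](_ : _ = y / u j * (p i j * Z)); last by ring.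
  rewrite -[leRHS]mulrA; apply: ler_wpM2r => //.
  by rewrite mulr_ge0 ?prob_ge0.
rewrite mxE -/a -/p -/f -/y.
have -> : x 0 i
    - (exit_rate N i + \sum_j Num.min (a j - x 0 j) (demand N d x j)
         / demand N d x j * p i j) * y
    + Num.min (a i - x 0 i) (demand N d x i) - xs 0 i
  = (x 0 i - xs 0 i - (exit_rate N i + \sum_j g j * p i j) * y
      + Num.min (a i - x 0 i) (fs i))
    + (Num.min (a i - x 0 i) (w i) - Num.min (a i - x 0 i) (fs i))
    + (\sum_j (g j - h j) * p i j) * y.
  under [X in _ = _ + X * y]eq_bigr do rewrite mulrBl.
  by rewrite sumrB -/(w i); rewrite /h /w; ring.
apply: (le_trans (ler_normD _ _)).
apply: le_trans (lerD (le_trans (ler_normD _ _) (lerD hT1 hT2)) hT3) _.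
rewrite [X in _ <= X](bigD1 i)//= [Gamma i i]mxE eqxx -addrA lerD2l.
rewrite [X in _ + (X + _)](bigD1 i)//= [p i i]prob_diag mulr0 mul0r add0r.
rewrite -!big_split/= le_eqVlt; apply/orP; left; apply/eqP.
apply: eq_bigr => j /negPf ji; rewrite [Gamma i j]mxE eq_sym ji.
rewrite /ex invfM -/p -/fs -/(den i j) /e.
by rewrite /den; ring.
Qed.

End Equilibrium.

(** * From the gain inequality to exponential stability *)

Lemma enorm_le_sum_norm (R : realType) (n : nat) (x : 'rV[R]_n) :
  enorm x <= \sum_i `|x 0 i|.
Proof.
have S0 : 0 <= \sum_i `|x 0 i| by apply: sumr_ge0.
rewrite -(ger0_norm S0) -sqrtr_sqr ler_wsqrtr// expr2 mulr_suml.
apply: ler_sum => i _; rewrite -real_normK ?num_real// expr2 ler_wpM2l//.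
by rewrite (bigD1 i)//= lerDl sumr_ge0.
Qed.

Lemma sum_norm_le_enorm (R : realType) (n : nat) (x : 'rV[R]_n) :
  \sum_i `|x 0 i| <= n%:R * enorm x.
Proof.
apply: (@le_trans _ _ (\sum_(i < n) enorm x)).
  apply: ler_sum => i _; rewrite -sqrtr_sqr ler_wsqrtr// (bigD1 i)//= lerDl.
  by apply: sumr_ge0 => j _; rewrite sqr_ge0.
by rewrite sumr_const card_ord mulr_natl.
Qed.

(** During the first [m] steps the growth is at most [K^m], while [r^t] stays
    above [r^m]; the quotient of these two bounds absorbs the transient. *)
Lemma exponential_decay_after_transient (R : realFieldType) (E : nat -> R)
    (m : nat) (K C r : R) :
  1 <= K -> 0 <= C -> 0 < r < 1 -> 0 <= E 0%N ->
  (forall t, E t.+1 <= K * E t) -> (forall t, E (t + m)%N <= C * r ^+ t * E m) ->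
  forall t, E t <= (1 + C) * (K ^+ m / r ^+ m) * r ^+ t * E 0%N.
Proof.
move=> K1 C0 /andP[r0 r1] E0 hK hC.
have K0 : 0 <= K by apply: le_trans K1.
have grow t : E t <= K ^+ t * E 0%N.
  elim: t => [|t IH]; first by rewrite mul1r.
  by apply: le_trans (hK t) _; rewrite exprS -mulrA ler_wpM2l.
have rm : 0 < r ^+ m by rewrite exprn_gt0.
have Km : 0 <= K ^+ m by rewrite exprn_ge0.
move=> t; have [mt|tm] := leqP m t.
  rewrite -[in leLHS](subnK mt); apply: le_trans (hC _) _.
  apply: (@le_trans _ _ (C * r ^+ (t - m) * (K ^+ m * E 0%N))).
    by apply: ler_wpM2l; rewrite ?grow// mulr_ge0// exprn_ge0// ltW.
  rewrite -[in leRHS](subnK mt) exprD.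
  have -> : (1 + C) * (K ^+ m / r ^+ m) * (r ^+ (t - m) * r ^+ m) * E 0%N
      = (1 + C) * r ^+ (t - m) * (K ^+ m * E 0%N).
    by field; rewrite gt_eqF.
  apply: ler_wpM2r; first by rewrite mulr_ge0.
  by apply: ler_wpM2r; rewrite ?lerDr// exprn_ge0// ltW.
apply: le_trans (grow t) _; apply: ler_wpM2r => //.
apply: (@le_trans _ _ (K ^+ m)); first exact/ler_weXn2l/ltnW.
have gain : 1 <= (r ^+ m)^-1 * r ^+ t.
  by rewrite mulrC ler_pdivlMr// mul1r ler_wiXn2l ?ltW// ltnW.
have -> : (1 + C) * (K ^+ m / r ^+ m) * r ^+ t
    = K ^+ m * ((1 + C) * ((r ^+ m)^-1 * r ^+ t)) by ring.
by rewrite ler_peMr// -[leLHS]mul1r ler_pM// lerDl.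
Qed.

Unset Implicit Arguments.

Theorem theorem3p1 (R : realType) (n q : nat) (N : network R n q)
  (xs : 'rV[R]_n) (b c : 'I_n -> R) (L : R)
  (lambda mu omega F : 'I_n -> R)
  (hxs : is_equilibrium N xs)
  (hbc : forall i, 0 <= b i /\ b i < c i /\ c i <= capacity N i)
  (hA : trapping_region N (box b c))
  (hL : 0 <= L)
  (hfL : forall i (d : 'rV[R]_q) (x : R), disturbance N d -> 0 <= x <= capacity N i ->
    `|flow N i d x - eq_flow N i| <= L * `|x - xs 0 i|)
  (hlambda : forall i, 0 <= lambda i)
  (hmu : forall i, 0 <= mu i)
  (homega : forall i, xs 0 i <= omega i < capacity N i)
  (hflambda : forall i (d : 'rV[R]_q) (x : R) (theta : 'I_n -> R),
    disturbance N d -> b i <= x <= c i ->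
    (forall j, 0 <= theta j <= 1) ->
    `| x - xs 0 i
       - (exit_rate N i + \sum_(j < n)
            Num.min (capacity N j - theta j * omega j)
                    (partial_demand N i j d x)
              / partial_demand N i j d x * prob N i j)
         * flow N i d x
       + Num.min (capacity N i - x)
                 (inflow N i + \sum_(j < n) prob N j i * eq_flow N j) |
    <= lambda i * `|x - xs 0 i|)
  (hfmu : forall i (d : 'rV[R]_q) (x : R), disturbance N d -> b i <= x <= c i ->
    `|eq_flow N i - flow N i d x| <= mu i * `|x - xs 0 i|)
  (hF : forall i, is_maximum
    [set flow N i d x | d in disturbance N & x in (`[b i, c i] : set R)] (F i))
  (hFcap : forall i j,
    eq_flow N j + prob N i j * (F i - eq_flow N i) <= capacity N j)
  (hrho : spectral_radius (gain_matrix N xs c omega lambda mu F) < 1) :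
  RGES N xs.
Proof.
have [_ [m hm]] := hA.
have [K [K1 hK]] := step_expansion hxs hL hfL.
have G0 i j : 0 <= gain_matrix N xs c omega lambda mu F i j.
  exact: (gain_matrix_ge0 hxs hbc hlambda hmu homega hF).
have [C [r [C0 r01 hC]]] := linear_comparison_decay G0 hrho.
pose M0 := (1 + C) * (K ^+ m / r ^+ m).
have /andP[r0 r1] := r01.
have M0_gt0 : 0 < M0.
  rewrite mulr_gt0//; first by rewrite ltr_wpDr.
  by rewrite divr_gt0// exprn_gt0// (lt_le_trans ltr01).
exists (M0 * n.+1%:R), (- ln r); split.
- by rewrite mulr_gt0.
- by rewrite oppr_gt0 ln_lt0.
move=> x0 d hx0 hd t.
pose E t := \sum_i `|solution N x0 d t 0 i - xs 0 i|.
have hS s : state_space N (solution N x0 d s) by apply: solution_state_space.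
have EK t' : E t'.+1 <= K * E t' by apply: hK.
have EC t' : E (t' + m)%N <= C * r ^+ t' * E m.
  apply: (hC (fun t i => `|solution N x0 d (t + m) 0 i - xs 0 i|)) => // s i.
  apply: (step_gain hxs hbc hmu homega hflambda hfmu hF) => //.
  by apply: hm => //; apply: leq_addl.
have E0 : 0 <= E 0%N by apply: sumr_ge0.
have decay := exponential_decay_after_transient K1 C0 r01 E0 EK EC t.
have sumE s : \sum_i `|(solution N x0 d s - xs) 0 i| = E s.
  by apply: eq_bigr => i _; rewrite !mxE.
have -> : expR (- (- ln r * t%:R)) = r ^+ t.
  by rewrite mulNr opprK mulrC expRM_natl lnK.
apply: le_trans (enorm_le_sum_norm _) _; rewrite sumE.
apply: le_trans decay _; rewrite -/M0.
have rt : 0 <= M0 * r ^+ t by rewrite mulr_ge0 ?exprn_ge0// ltW.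
rewrite [leRHS](_ : _ = M0 * r ^+ t * (n.+1%:R * enorm (x0 - xs))); last by ring.
apply: ler_wpM2l => //; rewrite -(sumE 0%N).
apply: le_trans (sum_norm_le_enorm _) _.
by rewrite ler_wpM2r ?sqrtr_ge0// ler_nat.
Qed.
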